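(* Let $K$ be a metric space and $f:K\to\mathbb{C}$ a given function. Then $$\|\operatorname{osc}_\omega f\|_\infty=\sup\Bigl\{\sum_{i=1}^n\varepsilon_i:\ n\ge1,\ (\varepsilon_i)_{i=1}^n\text{ are positive real numbers with }\operatorname{os}_n(f,(\varepsilon_i))\ne\emptyset\Bigr\},$$ where the supremum of the empty set is taken to be $0$.
   Context: All $\limsup$'s are non-exclusive (the point itself is allowed). For $\varphi:K\to[-\infty,\infty]$, $U\varphi(x)=\limsup_{y\to x}\varphi(y)=\inf_V\sup_{y\in V}\varphi(y)$, the infimum over open neighborhoods $V$ of $x$. Transfinite oscillations: $\operatorname{osc}_0f\equiv0$. For an ordinal $\beta=\alpha+1$, $\widetilde{\operatorname{osc}}_\beta f(x)=\limsup_{y\to x}\bigl(|f(y)-f(x)|+\operatorname{osc}_\alpha f(y)\bigr)$; for a limit ordinal $\beta$, $\widetilde{\operatorname{osc}}_\beta f=\sup_{\alpha<\beta}\operatorname{osc}_\alpha f$; in both cases $\operatorname{osc}_\beta f=U\,\widetilde{\operatorname{osc}}_\beta f$. Put $\operatorname{osc}f=\operatorname{osc}_1f$. Values lie in $[0,\infty]$ and $\|\cdot\|_\infty$ denotes the supremum. Oscillation sets: for $\varepsilon\ge0$, $\operatorname{os}(f,\varepsilon)=\{x:\operatorname{osc}f(x)\ge\varepsilon\}$; $\operatorname{os}_1(f,(\varepsilon_i))=\operatorname{os}(f,\varepsilon_1)$ and, with $W=\operatorname{os}_j(f,(\varepsilon_i))$, $\operatorname{os}_{j+1}(f,(\varepsilon_i))=\operatorname{os}(f|W,\varepsilon_{j+1})$,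 the oscillation of $f|W$ being computed in the metric subspace $W$. *)

(* Defs.v *)
From HB Require Import structures.
From mathcomp Require Import all_boot all_order all_algebra.
From mathcomp Require Import all_classical all_reals all_analysis.
From mathcomp Require Export complex.

Set Implicit Arguments.
Unset Strict Implicit.
Unset Printing Implicit Defensive.

Import Order.TTheory GRing.Theory Num.Theory.

Local Open Scope classical_set_scope.
Local Open Scope ring_scope.
Local Open Scope ereal_scope.

(* Supremum in [0, +oo]: the supremum of the empty set is 0, not -oo. *)
Definition nnsup (R : realType) (A : set (\bar R)) : \bar R :=
  ereal_sup (0 |` A).

Definition sup_norm (R : realType) (T : Type) (g : T -> \bar R) : \bar R :=
  nnsup [set `|g x| | x in [set: T]].

(* The filter is the full neighbourhood filter of x, so the point x itself is
   allowed (a non-exclusive limsup). *)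
Definition U (R : realType) (T : topologicalType) (phi : T -> \bar R) (x : T) :
    \bar R :=
  limf_esup phi (nbhs x).

Fixpoint osc_fin (R : realType) (T : topologicalType) (f : T -> R[i])
    (n : nat) : T -> \bar R :=
  if n is m.+1 then
    let osc_tilde x :=
      U (fun y => (Normc.normc (f y - f x))%:E + osc_fin f m y) x in
    U osc_tilde
  else fun=> 0.

(* The ordinals below the limit ordinal omega are the natural numbers. *)
Definition osc_omega (R : realType) (T : topologicalType) (f : T -> R[i]) :
    T -> \bar R :=
  let osc_tilde x := ereal_sup [set osc_fin f n x | n in [set: nat]] in
  U osc_tilde.

Definition osc (R : realType) (T : topologicalType) (f : T -> R[i]) :
    T -> \bar R :=
  osc_fin f 1.

Definition os (R : realType) (T : topologicalType) (f : T -> R[i]) (e : R) :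
    set T :=
  [set x | e%:E <= osc f x].

(* os of the restriction f|W, as a subset of the ambient space: the oscillation
   is taken in the type of points of W with the topology (the one of the induced
   metric) that makes it a subspace of T. *)
Definition os_restr (R : realType) (T : topologicalType) (W : set T)
    (f : T -> R[i]) (e : R) : set T :=
  set_val @` os (fun w : set_type W => f (set_val w)) e.

(* The sequence e is indexed from 1, and only e 1, ..., e n are used. The value
   at n = 0 is a convention. *)
Fixpoint os_iter (R : realType) (T : topologicalType) (f : T -> R[i])
    (e : nat -> R) (n : nat) : set T :=
  match n with
  | 0%N => setT
  | m.+1 =>
      if m is 0%N then os f (e 1%N)
      else os_restr (os_iter f e m) f (e m.+1)
  end.

(* Main.v *)
(* If [x] lies in os_(n+1)(f, e), then near [x] there is [y] in os_n with points
   [z] of os_n near [y] such that |f z - f y| is almost e_(n+1) or more, so by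
   induction osc_(n+1) f x >= e_1 + ... + e_(n+1).  Conversely, osc_n f x > l
   unfolds to a tree of points whose successive distances |f y - f x| sum to more
   than l along every branch.  Rounding these distances down to multiples of a
   small d, and capping them, leaves finitely many possible sequences of
   thresholds, so by pigeonhole the same sequence serves points accumulating at x.
   As oscillation sets are closed, x itself lies in os_n for these thresholds;
   those equal to 0 can be dropped. *)
Require Import Defs.
From HB Require Import structures.
From mathcomp Require Import all_boot all_order all_algebra.
From mathcomp Require Import all_classical all_reals all_analysis.
From mathcomp Require Import lra.

Set Implicit Arguments.
Unset Strict Implicit.
Unset Printing Implicit Defensive.

Import Order.TTheory GRing.Theory Num.Theory.

Local Open Scope classical_set_scope.
Local Open Scope ring_scope.

(** * Subspace neighbourhoods and closures *)

Lemma nbhs_set_typeP (T : topologicalType) (W : set T) (x : W) (A : set W) :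
  nbhs x A <-> exists2 B, nbhs (set_val x) B & set_val @^-1` B `<=` A.
Proof.
split.
  rewrite nbhsE /= => -[_ [[C oC <-] Cx] CA].
  by exists C => //; exists C.
move=> [B]; rewrite !nbhsE => -[C [oC Cx] CB] BA.
exists (set_val @^-1` C); last by move=> y /CB /BA.
by split => //; exists C.
Qed.

Lemma closed_subset_closure (T : topologicalType) (A B : set T) (x : T) :
  closed B -> A `<=` B -> closure A x -> B x.
Proof. by move=> + AB clx => /closure_id ->; apply: (closureS AB). Qed.

(** Pigeonhole for accumulation: if each [A i] missed some neighbourhood of [x], the finite
    intersection of these would miss the union. *)
Lemma closure_fin_bigcup (T : topologicalType) (I : finType) (A : I -> set T)
    (x : T) :
  closure (\bigcup_i A i) x -> exists i, closure (A i) x.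
Proof.
move=> clx; apply: contrapT => /forallNP nclA.
have [y [[i _ Aiy] nAy]] :
    (\bigcup_i A i) `&` [set y | forall i, ~ A i y] !=set0.
  apply: clx; apply: (filter_forall (f := fun i y => ~ A i y)) => i.
  have /existsNP[B /not_implyP[xB AB0]] := nclA i.
  by apply: filterS xB => y By Aiy; apply: AB0; exists y.
exact: nAy Aiy.
Qed.

(** * Strict and weak comparison with reals *)

Section ereal_extra.
Variable R : realType.
Implicit Types (u : \bar R) (r : R).
Local Open Scope ereal_scope.

Lemma fin_lte_between r u : r%:E < u -> exists2 c : R, (r < c)%R & c%:E < u.
Proof.
case: u => [s| _|]; last by rewrite ltNge leNye.
  rewrite lte_fin => rs; exists ((r + s) / 2)%R; first by lra.
  by rewrite lte_fin; lra.
by exists (r + 1)%R; [lra | rewrite ltry].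
Qed.

Lemma fin_lee_ltP r u :
  r%:E <= u <-> forall c : R, (c < r)%R -> c%:E < u.
Proof.
split=> [ru c cr|H]; first by apply: lt_le_trans ru; rewrite lte_fin.
rewrite leNgt; apply/negP => ur.
have [c cr uc] : exists2 c : R, (c < r)%R & u <= c%:E.
  case: u ur {H} => [s||]; rewrite ?ltNye //.
    by rewrite lte_fin => sr; exists s.
  by move=> _; exists (r - 1)%R; [lra | rewrite leNye].
by have := lt_le_trans (H _ cr) uc; rewrite ltxx.
Qed.

End ereal_extra.

(** * Bounds on upper limits *)

Section limsup.
Variables (R : realType) (T : topologicalType).
Implicit Types (phi : T -> \bar R) (x : T) (c : \bar R) (A : set T).
Local Open Scope ereal_scope.

Lemma lt_U phi x c A : c < U phi x -> nbhs x A -> exists2 y, A y & c < phi y.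
Proof.
move=> cU xA; have : c < ereal_sup (phi @` A).
  by apply: lt_le_trans cU _; apply: ereal_inf_lbound; exists A.
by case/ereal_sup_gtP => _ [y Ay <-] cy; exists y.
Qed.

Lemma le_U phi x c :
  (forall A, nbhs x A -> exists2 y, A y & c <= phi y) -> c <= U phi x.
Proof.
move=> H; apply: le_ereal_inf_tmp => _ [A xA <-].
have [y Ay /le_trans -> //] := H _ xA.
by apply: ereal_sup_ubound; exists y.
Qed.

Lemma le_U_self phi x : phi x <= U phi x.
Proof. by apply: le_U => A /nbhs_singleton Ax; exists x. Qed.

End limsup.

(** * Oscillation sets expressed through closures *)

Lemma normc_ge0 (R : realType) (z : R[i]) : 0 <= Normc.normc z.
Proof. by case: z => a b; exact: sqrtr_ge0. Qed.

(** [c < limsup] gives this property, which gives back only [c <= limsup]; hence [rel_os] quantifies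
    over all [c < e]. *)
Definition far (R : realType) (T : topologicalType) (f : T -> R[i]) (W : set T)
    (x : T) (c : R) : Prop :=
  forall A, nbhs x A -> exists z, [/\ A z, W z & c < Normc.normc (f z - f x)].

(* The set os(f|W, e), described inside the ambient space without extended
   reals. *)
Definition rel_os (R : realType) (T : topologicalType) (f : T -> R[i])
    (W : set T) (e : R) : set T :=
  [set x | W x /\ forall c, c < e -> closure [set y | W y /\ far f W y c] x].

Lemma osP (R : realType) (T : topologicalType) (f : T -> R[i]) (e : R) (x : T) :
  os f e x <-> forall c, c < e -> closure [set y | far f setT y c] x.
Proof.
rewrite /os /= fin_lee_ltP; split=> H c ce.
  move=> A xA; have [y Ay cy] := lt_U (H _ ce) xA.
  exists y; split => // B yB; have [z Bz] := lt_U cy yB.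
  by rewrite /= adde0 lte_fin => cz; exists z.
(* [le_U] yields only a weak bound; aiming at the midpoint restores the strict one. *)
have cm : c < (c + e) / 2 by lra.
have me : (c + e) / 2 < e by lra.
apply: (@lt_le_trans _ _ ((c + e) / 2)%:E); first by rewrite lte_fin.
apply: le_U => A xA; have [y [fy Ay]] := H _ me _ xA.
exists y => //; apply: le_U => B yB; have [z [Bz _ mz]] := fy _ yB.
by exists z => //=; rewrite adde0 lee_fin ltW.
Qed.

Section oscillation_sets.
Variables (R : realType) (T : topologicalType) (f : T -> R[i]).
Implicit Types (W : set T) (e : R) (s : seq R) (x : T).

Local Notation dist x y := (Normc.normc (f y - f x)).

Lemma os_rel_os e : os f e = rel_os f setT e.
Proof.
apply/seteqP; split=> x /=.
  by rewrite osP => H; split => // c /H; apply: closureS.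
by case=> _ H; rewrite osP => c /H; apply: closureS => y [].
Qed.

Lemma os_restr_rel_os W e : os_restr W f e = rel_os f W e.
Proof.
have farE (y : W) c :
    far (fun w : W => f (set_val w)) setT y c <-> far f W (set_val y) c.
  split=> H A.
    move=> yA; have [|z [Az _ cz]] := H (set_val @^-1` A).
      by apply/nbhs_set_typeP; exists A.
    by exists (set_val z); split => //; apply: set_valP.
  move=> /nbhs_set_typeP[B yB BA]; have [z [Bz Wz cz]] := H _ yB.
  by exists (exist _ z (mem_set Wz)); split => //; apply: BA.
apply/seteqP; split=> x /=.
  case=> w /osP H <-; split; first exact: set_valP.
  move=> c /H clw A wA.
  have [|y [fy Ay]] := clw (set_val @^-1` A).
    by apply/nbhs_set_typeP; exists A.
  exists (set_val y); split => //; split; first exact: set_valP.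
  exact/farE.
case=> Wx H; exists (exist _ x (mem_set Wx)) => //; apply/osP => c /H clx A.
move=> /nbhs_set_typeP[B xB BA]; have [y [[Wy fy] By]] := clx _ xB.
exists (exist _ y (mem_set Wy)); split; last exact: BA.
exact/farE.
Qed.

Lemma os_iterS (e : nat -> R) n :
  os_iter f e n.+1 = rel_os f (os_iter f e n) (e n.+1).
Proof.
by case: n => [|n] /=; [rewrite os_rel_os | rewrite os_restr_rel_os].
Qed.

(** The set is [W] intersected with closures. Closedness later carries membership over to limit
    points. *)
Lemma closed_rel_os W e : closed W -> closed (rel_os f W e).
Proof.
move=> cW x clx; split.
  by apply: closed_subset_closure clx => // y [].
move=> c ce; apply: closed_subset_closure clx; first exact: closed_closure.
by move=> y [_]; apply.
Qed.

(** For [c < 0] each point is its own witness. Rounding down can produce zero thresholds, which may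
    thus be discarded. *)
Lemma rel_os0 W : rel_os f W 0 = W.
Proof.
apply/seteqP; split=> x; first by case.
move=> Wx; split=> // c c0; apply: subset_closure; split=> // A xA.
exists x; split=> //; first exact: nbhs_singleton.
exact: lt_le_trans c0 (normc_ge0 _).
Qed.

(* [os_seq] takes the thresholds in reverse order: the last one comes first. *)
Fixpoint os_seq s : set T :=
  if s is e :: s' then rel_os f (os_seq s') e else setT.

Lemma closed_os_seq s : closed (os_seq s).
Proof.
by elim: s => [|e s IHs] /=; [exact: closedT | exact: closed_rel_os].
Qed.

Lemma os_seq_filter0 s : os_seq [seq e <- s | e != 0] = os_seq s.
Proof.
elim: s => //= e s IHs; case: eqVneq => [->|_] /=; last by rewrite IHs.
by rewrite rel_os0.
Qed.

Lemma eq_os_iter (e e' : nat -> R) n :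
  (forall i, (1 <= i <= n)%N -> e i = e' i) -> os_iter f e n = os_iter f e' n.
Proof.
elim: n => // n IHn H; rewrite !os_iterS H ?leqnn // IHn // => i /andP[i0 ni].
by rewrite H // i0 ltnW.
Qed.

Lemma os_seq_iter s :
  os_seq s = os_iter f (fun i => nth 0 (rev s) i.-1) (size s).
Proof.
elim: s => // e s IHs; rewrite [size _]/= os_iterS /= rev_cons nth_rcons.
rewrite size_rev ltnn eqxx IHs; congr (rel_os f _ _).
(* The new threshold stands last in the reversed list, so entries [1] to [size s] are unchanged. *)
by apply: eq_os_iter => -[|i] //= is'; rewrite nth_rcons size_rev is'.
Qed.

(** * Finite-order oscillations against sums of thresholds *)

Local Open Scope ereal_scope.

Lemma osc_fin_ge0 n x : 0 <= osc_fin f n x.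
Proof.
elim: n x => // n IHn x /=; apply: le_trans (le_U_self _ _).
apply: le_trans (le_U_self _ _).
by rewrite adde_ge0 // lee_fin normc_ge0.
Qed.

Lemma osc_fin_le_omega n x : osc_fin f n x <= osc_omega f x.
Proof.
rewrite /osc_omega; apply: le_trans (le_U_self _ _).
by apply: ereal_sup_ubound; exists n.
Qed.

Lemma os_iter_le_osc_fin (e : nat -> R) n x :
  os_iter f e n x -> (\sum_(1 <= i < n.+1) e i)%:E <= osc_fin f n x.
Proof.
elim: n x => [|n IHn] x; first by rewrite big_geq.
rewrite os_iterS big_nat_recr //= => -[_ clx].
apply/fin_lee_ltP => c.
set S := (\sum_(1 <= i < n.+1) e i)%R in IHn * => cS.
(* The midpoint of [c - S] and [e n.+1] is below the threshold, yet adding [S] to it still exceeds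
   [c]. *)
have /clx {}clx : ((c - S + e n.+1) / 2 < e n.+1)%R by lra.
set m := ((c - S + e n.+1) / 2)%R in clx.
have cm : (c < m + S)%R by rewrite /m; lra.
apply: (@lt_le_trans _ _ (m + S)%:E); first by rewrite lte_fin.
apply: le_U => A xA; have [y [[_ fy] Ay]] := clx _ xA.
exists y => //; apply: le_U => B yB; have [z [Bz Wz mz]] := fy _ yB.
exists z => //; rewrite EFinD leeD ?lee_fin ?(ltW mz) //.
exact: IHn.
Qed.

(* Recording [k = minn M (truncn (dist / d))] instead of the distance costs at
   most [d] at each level and leaves finitely many candidate tuples [t]. *)
Lemma osc_fin_os_seq (d : R) (M n : nat) (l : R) x :
  (0 < d)%R -> (l <= d * M%:R)%R -> l%:E < osc_fin f n x ->
  exists2 t : n.-tuple 'I_M.+1,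
    os_seq [seq (d * (k : nat)%:R)%R | k : 'I_M.+1 <- t] x &
    (l <= d * (\sum_(k <- t) nat_of_ord k + n)%:R)%R.
Proof.
move=> d0; elim: n l x => [|n IHn] l x lM /=.
  rewrite lte_fin => l0; exists [tuple] => //.
  by rewrite big_nil mulr0 ltW.
(* Each order of oscillation has two nested upper limits, so the pigeonhole is used twice: on [A] at
   [x], then on [B] at [y]. *)
pose A (t : n.+1.-tuple 'I_M.+1) := [set y |
  os_seq [seq (d * (k : nat)%:R)%R | k : 'I_M.+1 <- t] y /\
    (l <= d * (\sum_(k <- t) nat_of_ord k + n.+1)%:R)%R].
move=> lx; suff /closure_fin_bigcup[t] : closure (\bigcup_t A t) x.
  (* The inequality in [A t] does not mention the point, so any one point supplies it. *)
  move=> clx; have [y [[_ lt] _]] := clx setT filterT.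
  exists t => //; apply: closed_subset_closure clx; first exact: closed_os_seq.
  by move=> ? [].
move=> V xV; have [y Vy ly] := lt_U lx xV.
exists y; split=> //.
pose B (t : n.+1.-tuple 'I_M.+1) := [set z |
  [/\ os_seq [seq (d * (k : nat)%:R)%R | k : 'I_M.+1 <- behead t] z,
    (d * (thead t : nat)%:R <= dist y z)%R &
    (l <= d * (\sum_(k <- t) nat_of_ord k + n.+1)%:R)%R]].
have /closure_fin_bigcup[t clt] : closure (\bigcup_t B t) y.
  move=> V' yV'; have [z Vz lz] := lt_U ly yV'.
  exists z; split=> //.
  pose k := minn M (Num.truncn (dist y z / d)%R).
  have kM : (k < M.+1)%N by rewrite ltnS geq_minl.
  have kd : (d * k%:R <= dist y z)%R.
    rewrite mulrC -ler_pdivlMr //.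
    have /truncn_itv/andP[+ _] : (0 <= dist y z / d)%R.
      exact: divr_ge0 (normc_ge0 _) (ltW d0).
    by apply: le_trans; rewrite ler_nat geq_minr.
  have lkz : (l - d * k.+1%:R)%:E < osc_fin f n z.
    (* If the cap [M] is reached, [l <= d * M] makes the new bound negative; otherwise rounding
       loses less than [d]. *)
    case: (leqP M (Num.truncn (dist y z / d)%R)) => Mz.
      apply: lt_le_trans (osc_fin_ge0 _ _); rewrite lte_fin subr_lt0.
      by apply: le_lt_trans lM _; rewrite ltr_pM2l // ltr_nat /k (minn_idPl Mz).
    have dk : (dist y z < d * k.+1%:R)%R.
      rewrite mulrC -ltr_pdivrMr // /k (minn_idPr (ltnW Mz)).
      exact: truncnS_gt.
    apply: (@lt_trans _ _ (l - dist y z)%:E).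
      by rewrite lte_fin ltrD2l ltrN2.
    by rewrite EFinB lteBlDl.
  have [|t Wt lt] := IHn _ _ _ lkz.
    apply: le_trans lM; rewrite gerBl mulr_ge0 ?ltW //.
  exists [tuple of Ordinal kM :: t] => //; split => //=.
  rewrite big_cons /= addnS -addnA addnC -addnS natrD mulrDr -lerBlDr.
  exact: lt.
have [z [[_ _ lt] _]] := clt setT filterT.
have Wy : os_seq [seq (d * (k : nat)%:R)%R | k : 'I_M.+1 <- behead t] y.
  apply: closed_subset_closure clt; first exact: closed_os_seq.
  by move=> ? [].
(* Points of [B t] near [y] have values at distance at least the head threshold from [f y], so [y]
   is its own witness. *)
exists t => //; split=> //; rewrite [t]tuple_eta /=; split=> // c ct.
apply: subset_closure; split=> // V' yV'.
have [z' [[Wz' tz' _] V'z']] := clt _ yV'.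
by exists z'; split=> //; apply: lt_le_trans ct tz'.
Qed.

End oscillation_sets.

Theorem lemma3 (R : realType) (K : metricType R) (f : K -> R[i]) :
  sup_norm (osc_omega f) =
  nnsup [set s : \bar R | exists (n : nat) (e : nat -> R),
    [/\ (1 <= n)%N,
        (forall i : nat, (1 <= i <= n)%N -> 0 < e i),
        os_iter f e n !=set0
      & s = (\sum_(1 <= i < n.+1) e i)%:E]].
Proof.
have osc_ge0 x : (0 <= osc_omega f x)%E.
  exact: le_trans (osc_fin_ge0 f 0 x) (osc_fin_le_omega _ _ _).
apply/eqP; rewrite eq_le; apply/andP; split; last first.
  apply: ge_ereal_sup => _ [->|[n [e [_ _ [x ex] ->]]]].
    by apply: ereal_sup_ubound; left.
  apply: le_trans (os_iter_le_osc_fin ex) _.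
  apply: le_trans (osc_fin_le_omega _ _ _) _.
  by apply: ereal_sup_ubound; right; exists x => //; rewrite gee0_abs.
set S := nnsup _; have S0 : (0 <= S)%E by apply: ereal_sup_ubound; left.
apply: ge_ereal_sup => _ [->//|[x _ <-]]; rewrite gee0_abs //.
rewrite leNgt; apply/negP => Sx.
have [r Sr] : exists r, S = r%:E.
  case: S S0 Sx => [r _ _|_|]; first by exists r.
    by rewrite ltNge leey.
  by rewrite leeNy_eq.
have Sub : (S <= r%:E)%E by rewrite Sr.
rewrite Sr lee_fin in S0 Sx.
have [y _ /ereal_sup_gtP[_ [n _ <-]]] := lt_U Sx filterT.
move=> /fin_lte_between[l rl ly].
(* Rounding over [n] levels costs at most [n * d], which is less than [l - r]. *)
pose d := (l - r) / n.+1%:R.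
have d0 : 0 < d by rewrite divr_gt0 ?subr_gt0.
have lM : l <= d * (Num.truncn (l / d)).+1%:R.
  by rewrite mulrC -ler_pdivrMr // ltW ?truncnS_gt.
have [t Wt lt] := osc_fin_os_seq d0 lM ly.
set s := [seq _ | _ <- _] in Wt.
pose s' := [seq e <- s | e != 0].
have sum_s' : \sum_(e <- s') e = d * (\sum_(k <- t) nat_of_ord k)%:R.
  rewrite big_filter big_rmcond => [|e /negPn/eqP //].
  by rewrite big_map natr_sum mulr_sumr.
have rs' : r < \sum_(e <- s') e.
  rewrite sum_s'; move: lt; rewrite natrD mulrDr -lerBlDr; apply: lt_le_trans.
  rewrite ltrBrDr -ltrBrDl /d mulrAC ltr_pdivrMr // ltr_pM2l ?subr_gt0 //.
  by rewrite ltr_nat.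
have s'_gt0 e : e \in s' -> 0 < e.
  rewrite mem_filter => /andP[e0 /mapP[k _ ek]].
  by rewrite lt_def e0 ek mulr_ge0 // ltW.
suff : ((\sum_(e <- s') e)%:E <= S)%E.
  by move=> /le_trans /(_ Sub); rewrite lee_fin leNgt rs'.
apply: ereal_sup_ubound; right.
exists (size s'), (fun i => nth 0 (rev s') i.-1); split.
(* Since [0 <= r], the empty list would contradict [rs']. *)
- by case: (s') rs' => //; rewrite big_nil ltNge S0.
- move=> [//|i] /= is'; apply: s'_gt0.
  by rewrite -mem_rev mem_nth // size_rev.
- by exists y; rewrite -os_seq_iter os_seq_filter0.
- by congr (_%:E); rewrite -big_rev (big_nth 0) big_add1 size_rev.
Qed.
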